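(* Let $D$ be a dataset over items $A=\{a_1,\dots,a_N\}$, $\mathcal{C}$ an itemset collection, and $\mathcal{F}$ a candidate collection of itemsets. Let $s$ denote either the BIC or the MDL score. Then $$\arg\min_{X\in\mathcal{F}} s(\mathcal{C}\cup\{X\})=\arg\max_{X\in\mathcal{F}}\Big(KL\big(p^*_{\mathcal{C}\cup\{X\}}\,\|\,p^*_{\mathcal{C}}\big)-r(X)\Big)=\arg\min_{X\in\mathcal{F}}\Big(KL\big(q_D\,\|\,p^*_{\mathcal{C}\cup\{X\}}\big)+r(X)\Big),$$ where $r(X)=0$ if $s$ is BIC and $r(X)=|X|\log N/|D|$ if $s$ is MDL.
   Context: Transactions are $t\in\mathcal{T}=\{0,1\}^N$; $S_X(t)=1$ iff $t_i=1$ for all $a_i\in X$; a dataset $D$ is a finite nonempty multiset of transactions, $\mathrm{fr}(X)$ the fraction of its transactions supporting $X$, and $q_D(A=t)=|\{t'\in D: t'=t\}|/|D|$ its empirical distribution. For a collection $\mathcal{C}=(X_1,\dots,X_k)$ (frequencies taken from $D$), $p^*_{\mathcal{C}}$ is the unique entropy-maximizing distribution on $\mathcal{T}$ with $p(X_i=1)=\mathrm{fr}(X_i)$ for all $i$, where $p(X=1)=\sum_{t:S_X(t)=1}p(A=t)$; $\log p^*_{\mathcal{C}}(D)=\sum_{t\in D}\log p^*_{\mathcal{C}}(A=t)$; logs base 2. $KL(p\|q)=\sum_t p(A=t)\log\frac{p(A=t)}{q(A=t)}$. $s(\mathcal{C})$ abbreviates $s(\mathcal{C},D)$, with $\mathrm{BIC}(\mathcal{C},D)=-\log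 p^*_{\mathcal{C}}(D)+\frac{k}{2}\log|D|$ and, with $x=\sum_i|X_i|$, $l_1=\log|D|+N\log(1+N^{-1})+1$, $l_2=\log N$, $\mathrm{MDL}(\mathcal{C},D)=-\log p^*_{\mathcal{C}}(D)+l_1k+l_2x+1$.
   Formalization: The collection C∪{X} is read as (X_1,…,X_k,X), so a candidate X already in C is counted again in k and in the total size; with literal set union the claim fails when the candidate collection F meets C. *)

(* Defs.v *)
From HB Require Import structures.
From mathcomp Require Import all_boot all_order all_algebra.
From mathcomp Require Import all_classical all_reals all_analysis.

Set Implicit Arguments.
Unset Strict Implicit.
Unset Printing Implicit Defensive.

Import Order.TTheory GRing.Theory Num.Theory.

Local Open Scope ring_scope.

Notation transaction N := {ffun 'I_N -> bool}.
Notation itemset N := {set 'I_N}.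

Definition supports (N : nat) (X : itemset N) (t : transaction N) : bool :=
  [forall i in X, t i].

(* Multisets of transactions are sequences: every notion below is invariant
   under permutation of the dataset. *)
Definition freq (R : realType) (N : nat) (D : seq (transaction N))
    (X : itemset N) : R :=
  (count (supports X) D)%:R / (size D)%:R.

Definition empirical (R : realType) (N : nat) (D : seq (transaction N)) :
    {ffun transaction N -> R} :=
  [ffun t => (count_mem t D)%:R / (size D)%:R].

Definition is_distr (R : realType) (N : nat)
    (p : {ffun transaction N -> R}) : Prop :=
  (forall t, 0 <= p t) /\ \sum_t p t = 1.

Definition prob_itemset (R : realType) (N : nat)
    (p : {ffun transaction N -> R}) (X : itemset N) : R :=
  \sum_(t | supports X t) p t.

Definition log2 (R : realType) (x : R) : R := ln x / ln 2.

(* Extended logarithm, so that log 0 = -oo. *)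
Definition elog2 (R : realType) (x : \bar R) : \bar R :=
  (lne x * ((ln 2)^-1)%:E)%E.

(* Terms with p t = 0 vanish, which is the convention 0 log 0 = 0. *)
Definition entropy (R : realType) (N : nat)
    (p : {ffun transaction N -> R}) : R :=
  - \sum_t p t * log2 (p t).

(* In \bar R, r / 0 = +oo for r > 0 and 0 * x = 0 for every x, including +oo
   and -oo. Hence a term with p t = 0 is 0, and one with q t = 0 < p t is +oo. *)
Definition KL (R : realType) (N : nat)
    (p q : {ffun transaction N -> R}) : \bar R :=
  (\sum_t (p t)%:E * elog2 ((p t)%:E / (q t)%:E))%E.

Definition feasible (R : realType) (N : nat) (D : seq (transaction N))
    (C : seq (itemset N)) (p : {ffun transaction N -> R}) : Prop :=
  is_distr p /\ (forall X, X \in C -> prob_itemset p X = freq R D X).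

Definition is_maxent (R : realType) (N : nat) (D : seq (transaction N))
    (C : seq (itemset N)) (p : {ffun transaction N -> R}) : Prop :=
  feasible D C p /\
  (forall q : {ffun transaction N -> R},
     feasible D C q -> entropy q <= entropy p).

(* The default value 0 of xget is not a distribution; it would be returned
   only if no maximizer existed. *)
Definition pstar (R : realType) (N : nat) (D : seq (transaction N))
    (C : seq (itemset N)) : {ffun transaction N -> R} :=
  xget [ffun=> 0] [set p | is_maxent D C p]%classic.

Definition loglik (R : realType) (N : nat)
    (p : {ffun transaction N -> R}) (D : seq (transaction N)) : \bar R :=
  (\sum_(t <- D) elog2 (p t)%:E)%E.

Definition BIC (R : realType) (N : nat) (C : seq (itemset N))
    (D : seq (transaction N)) : \bar R :=
  (- loglik (pstar R D C) D
   + ((size C)%:R / 2 * log2 (size D)%:R)%:E)%E.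

Definition mdl_l1 (R : realType) (N : nat) (D : seq (transaction N)) : R :=
  log2 (size D)%:R + N%:R * log2 (1 + N%:R^-1) + 1.

Definition mdl_l2 (R : realType) (N : nat) : R := log2 N%:R.

Definition MDL (R : realType) (N : nat) (C : seq (itemset N))
    (D : seq (transaction N)) : \bar R :=
  (- loglik (pstar R D C) D
   + (mdl_l1 R D * (size C)%:R
      + mdl_l2 R N * (\sum_(X <- C) #|X|)%:R + 1)%:E)%E.

Inductive score_kind := BICscore | MDLscore.

Definition score (R : realType) (s : score_kind) (N : nat)
    (C : seq (itemset N)) (D : seq (transaction N)) : \bar R :=
  match s with
  | BICscore => BIC R C D
  | MDLscore => MDL R C D
  end.

Definition penalty (R : realType) (s : score_kind) (N : nat)
    (D : seq (transaction N)) (X : itemset N) : R :=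
  match s with
  | BICscore => 0
  | MDLscore => #|X|%:R * log2 N%:R / (size D)%:R
  end.

(* The union of a collection (X_1, ..., X_k) with {X} is the collection
   (X_1, ..., X_k, X) of k + 1 itemsets. It is the set-theoretic union when X
   is not already in the collection; a repeated X is counted again, since
   otherwise the penalty terms would not be uniform over the candidates. *)
Definition add_itemset (N : nat) (C : seq (itemset N)) (X : itemset N) :
    seq (itemset N) :=
  rcons C X.

Definition argmin (R : realType) (T : finType) (F : {set T}) (f : T -> \bar R) :
    {set T} :=
  [set X in F | [forall Y in F, (f X <= f Y)%E]].

Definition argmax (R : realType) (T : finType) (F : {set T}) (f : T -> \bar R) :
    {set T} :=
  [set X in F | [forall Y in F, (f Y <= f X)%E]].

(* Main.v *)
(* Let p be a maximum entropy distribution for a collection and q any feasible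
   distribution. By optimality of p and Gibbs' inequality, the mixture
   m = p + e (q - p), when it is feasible, satisfies
   e (sum q log m - sum p log p) >= 0 for e < 1. Letting e -> 0+ shows that the
   support of p contains that of q; the mixture is then feasible for small e of
   either sign, so sum q log p = sum p log p. Since q_D and p*_{C u {X}} are
   feasible for C, and q_D is feasible for C u {X},
     KL(p*_{C u {X}} || p*_C) = H(p*_C) - H(p*_{C u {X}}),
     KL(q_D || p*_{C u {X}}) = H(p*_{C u {X}}) - H(q_D),
     - log p*_{C u {X}}(D) = |D| H(p*_{C u {X}}),
   and all three optimizations minimize H(p*_{C u {X}}) + r(X). *)

Require Import Defs.
From mathcomp Require Import all_boot all_order all_algebra.
From mathcomp Require Import all_classical all_reals all_analysis.
From mathcomp Require Import ring lra.

Set Implicit Arguments.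
Unset Strict Implicit.
Unset Printing Implicit Defensive.

Import Order.TTheory GRing.Theory Num.Theory numFieldNormedType.Exports.

Local Open Scope classical_set_scope.
Local Open Scope ring_scope.

(** * Gibbs' inequality and continuity of the entropy summand *)

Lemma ln2_gt0 (R : realType) : 0 < ln 2 :> R.
Proof. by rewrite ln_gt0 // ltr1n. Qed.

(** Weight [ln x <= x - 1] at [x = q t / p t] by [p t] and sum; where [p t = 0] the bound is just
    [0 <= q t]. *)
Lemma gibbs (R : realType) (T : finType) (p q : T -> R) :
  (forall t, 0 <= p t) -> (forall t, 0 <= q t) ->
  \sum_t p t = 1 -> \sum_t q t = 1 -> (forall t, 0 < p t -> 0 < q t) ->
  \sum_t p t * log2 (q t) <= \sum_t p t * log2 (p t).
Proof.
move=> p0 q0 sp sq pq.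
have -> : \sum_t p t * log2 (q t) = (\sum_t p t * ln (q t)) / ln 2.
  by rewrite mulr_suml; apply: eq_bigr => t _; rewrite mulrA.
have -> : \sum_t p t * log2 (p t) = (\sum_t p t * ln (p t)) / ln 2.
  by rewrite mulr_suml; apply: eq_bigr => t _; rewrite mulrA.
rewrite ler_pM2r ?invr_gt0 ?ln2_gt0 // -subr_le0 -sumrB.
have /le_trans : \sum_t (p t * ln (q t) - p t * ln (p t))
    <= \sum_t (q t - p t); last first.
  by apply; rewrite sumrB sp sq subrr.
apply: ler_sum => t _; have := p0 t; rewrite le_eqVlt => /predU1P[<-|pt].
  by rewrite !mul0r !subr0.
have qt := pq t pt.
have rt : 0 < q t / p t by rewrite divr_gt0.
have /(@le_ln1Dx R) : -1 < q t / p t - 1 by rewrite ltrBrDl subrr.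
rewrite addrC subrK ln_div ?posrE // => h.
rewrite -mulrBr (le_trans (ler_wpM2l (ltW pt) h)) //.
by rewrite mulrBr mulr1 mulrCA divff ?mulr1 ?gt_eqF.
Qed.

(* Continuity at 0 comes from [|x ln x| <= 2 sqrt x] on ]0, 1[; for [x <= 0]
   the logarithm has the junk value 0. *)
Lemma continuous_xlog2x (R : realType) : continuous (fun x : R => x * log2 x).
Proof.
have bnd (y : R) : 0 < y < 1 -> `|y * ln y| <= 2 * Num.sqrt y.
  move=> /andP[y0 /ltW y1].
  rewrite normrM (gtr0_norm y0) ler0_norm ?ln_le0 //.
  (* With [z = sqrt y] the left side is [2 z^2 ln (1/z)], and [ln u < u] at [u = 1/z] bounds it by
     [2 z]. *)
  set z := Num.sqrt y; have z0 : 0 < z by rewrite sqrtr_gt0.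
  have -> : y = z ^+ 2 by rewrite sqr_sqrtr // ltW.
  rewrite lnXn // mulr2n expr2.
  have /ltW : ln z^-1 < z^-1 by apply: ln_sublinear; rewrite invr_gt0.
  rewrite lnV ?posrE // => /(ler_wpM2l (mulr_ge0 (ltW z0) (ltW z0))).
  rewrite -[_ * _ * z^-1]mulrA divff ?gt_eqF // mulr1; lra.
suff h : continuous (fun x : R => x * ln x).
  move=> x; rewrite /log2; under eq_fun do rewrite mulrA; apply: cvgMl; exact: h.
move=> x; have [x0|x0|->] := ltgtP x 0.
- rewrite /continuous_at ln0 ?ltW // mulr0; apply: cvg_near_cst.
  by near=> y; rewrite ln0 ?mulr0 //; apply/ltW; near: y; exact: lt_nbhsl.
- by apply: cvgM; [exact: cvg_id | exact: continuous_ln].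
- rewrite /continuous_at mul0r; apply/norm_cvg0P.
  apply: (@squeeze_cvgr _ _ _ _ (fun=> 0) (fun y => 2 * Num.sqrt `|y|)).
  + near=> y; rewrite normr_ge0 /=.
    have [y0|y0] := leP y 0; first by rewrite ln0 // mulr0 normr0 mulr_ge0.
    have y1 : y < 1 by near: y; exact: lt_nbhsl.
    by rewrite [in leRHS](gtr0_norm y0); apply: bnd; rewrite y0.
  + exact: cvg_cst.
  + have h : 2 * Num.sqrt `|y| @[y --> (0 : R)] --> 2 * Num.sqrt `|0 : R|.
      apply: cvgMr; apply: (continuous_comp (f := fun y : R => `|y|)).
        exact: norm_continuous.
      exact: sqrt_continuous.
    by move: h; rewrite normr0 sqrtr0 mulr0.
Unshelve. all: by end_near. Qed.

(** * Feasible distributions and first-order optimality *)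

Section Distributions.
Variables (R : realType) (N : nat).
Implicit Types (D : seq (transaction N)) (C : seq (itemset N)).
Implicit Types (X : itemset N) (p q : {ffun transaction N -> R}).

Lemma sum_count_mem D (f : transaction N -> R) :
  \sum_(x <- D) f x = \sum_t (count_mem t D)%:R * f t.
Proof.
elim: D => [|x D IH]; first by rewrite big_nil big1 // => t _; rewrite mul0r.
rewrite big_cons IH (bigD1 x) //= [in RHS](bigD1 x) //= eqxx natrD mulrDl mul1r.
rewrite addrA; congr (_ + _); apply: eq_bigr => t /negbTE tx.
by rewrite eq_sym tx.
Qed.

Lemma prob_itemset_sum p X : prob_itemset p X = \sum_t (supports X t)%:R * p t.
Proof.
rewrite /prob_itemset big_mkcond; apply: eq_bigr => t _.
by case: supports; rewrite ?mul1r ?mul0r.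
Qed.

Lemma feasible_empirical D C : D <> [::] -> feasible D C (empirical R D).
Proof.
move=> D0; have n0 : (size D)%:R != 0 :> R.
  by rewrite pnatr_eq0 size_eq0; apply/eqP.
(* Expectations under the empirical distribution are averages over [D]; [f = 1] and the indicator of
   support give the constraints. *)
have sE (f : transaction N -> R) :
    \sum_t f t * empirical R D t = (\sum_(t <- D) f t) / (size D)%:R.
  rewrite sum_count_mem mulr_suml; apply: eq_bigr => t _.
  by rewrite ffunE mulrCA mulrA.
split=> [|X _]; first split=> [t|].
- by rewrite ffunE divr_ge0.
- under eq_bigr do rewrite -[empirical R D _]mul1r.
  by rewrite sE -(natr_sum R D xpredT (fun=> 1%N)) sum1_size divff.
- rewrite prob_itemset_sum sE /freq; congr (_ / _).
  by rewrite -natr_sum -sum1_count [in RHS]big_mkcond.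
Qed.

Lemma distr_le1 p t : is_distr p -> p t <= 1.
Proof.
move=> [p0 <-]; rewrite (bigD1 t) //= lerDl; exact: sumr_ge0.
Qed.

(** [e] may be negative, which extrapolates beyond [p] away from [q]; nonnegativity is then a
    separate condition. *)
Definition mix p q (e : R) : {ffun transaction N -> R} :=
  [ffun t => p t + e * (q t - p t)].

Lemma sum_mix p q e (f : transaction N -> R) :
  \sum_t f t * mix p q e t = (1 - e) * \sum_t f t * p t + e * \sum_t f t * q t.
Proof.
rewrite !mulr_sumr -big_split; apply: eq_bigr => t _ /=; rewrite ffunE; ring.
Qed.

Lemma feasible_mix D C p q e : feasible D C p -> feasible D C q ->
  (forall t, 0 <= mix p q e t) -> feasible D C (mix p q e).
Proof.
move=> [[p0 p1] pC] [[q0 q1] qC] m0; split=> [|X XC]; first split=> //.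
  under eq_bigr do rewrite -[mix _ _ _ _]mul1r.
  rewrite sum_mix; under eq_bigr do rewrite mul1r.
  rewrite p1; under eq_bigr do rewrite mul1r.
  by rewrite q1; ring.
by rewrite prob_itemset_sum sum_mix -!prob_itemset_sum pC // qC //; ring.
Qed.

(** Optimality bounds the sum of [p log p] by that of [m log m], which is affine in the outer
    weights; Gibbs' inequality, scaled by [1 - e > 0], replaces [p log m] by [p log p]. *)
Lemma maxent_mix D C p q e : is_maxent D C p -> feasible D C q -> e < 1 ->
  (forall t, 0 <= mix p q e t) -> (forall t, 0 < p t -> 0 < mix p q e t) ->
  0 <= e * (\sum_t q t * log2 (mix p q e t) - \sum_t p t * log2 (p t)).
Proof.
move=> [pF pmax] qF e1 m0 mp.
have mF : feasible D C (mix p q e) by exact: feasible_mix.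
have [[[p0 p1] _] [[_ m1] _]] := (pF, mF).
have h1 := gibbs p0 m0 p1 m1 mp.
have mE : \sum_t mix p q e t * log2 (mix p q e t) =
    (1 - e) * (\sum_t p t * log2 (mix p q e t))
    + e * \sum_t q t * log2 (mix p q e t).
  rewrite !mulr_sumr -big_split; apply: eq_bigr => t _ /=.
  by rewrite [X in X * _]ffunE; ring.
have := pmax _ mF; rewrite /entropy lerN2 mE.
have : (1 - e) * (\sum_t p t * log2 (mix p q e t))
   <= (1 - e) * (\sum_t p t * log2 (p t)) by rewrite ler_wpM2l // subr_ge0 ltW.
lra.
Qed.

(** If [p t = 0 < q t], the term [q t * ln (e * q t)] is arbitrarily negative for small [e] while
    the other terms are nonpositive, against [maxent_mix]. An explicit [e] replaces the limit. *)
Lemma maxent_support D C p q t : is_maxent D C p -> feasible D C q ->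
  0 < q t -> 0 < p t.
Proof.
move=> pM qF qt; have [pF _] := pM.
have [[[p0 p1] _] [[q0 q1] _]] := (pF, qF).
rewrite lt_neqAle p0 andbT eq_sym; apply/eqP => pt.
set c := (\sum_t p t * log2 (p t)) * ln 2.
(* Chosen so that [q t * ln e = - q t * k = - |c| - q t], which is strictly below [c]. *)
set k := `|c| / q t + 1; have k0 : 0 < k by rewrite ltr_wpDl // divr_ge0 // ltW.
set e := expR (- k); have e0 : 0 < e by exact: expR_gt0.
have e1 : e < 1 by rewrite expR_lt1 oppr_lt0.
have m0 s : 0 <= mix p q e s.
  rewrite ffunE; have := p0 s; have := q0 s; nra.
have mp s : 0 < p s -> 0 < mix p q e s.
  rewrite ffunE => ps; have := q0 s; nra.
have [_ m1] := (feasible_mix pF qF m0).1.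
have := maxent_mix pM qF e1 m0 mp; rewrite pmulr_rge0 // subr_ge0.
rewrite -(ler_pM2r (ln2_gt0 R)) -/c leNgt => /negP; apply.
have -> : (\sum_s q s * log2 (mix p q e s)) * ln 2 = \sum_s q s * ln (mix p q e s).
  by rewrite mulr_suml; apply: eq_bigr => s _; rewrite mulrA divfK // gt_eqF ?ln2_gt0.
rewrite (bigD1 t) //= -ltrBrDr.
apply: (@lt_le_trans _ _ c); last first.
  rewrite lerBrDr gerDl; apply: sumr_le0 => s _; apply: mulr_ge0_le0 => //.
  by apply: ln_le0; exact: distr_le1 (feasible_mix pF qF m0).1.
rewrite ffunE pt subr0 add0r lnM ?posrE // expRK.
have lq : ln (q t) <= 0 by apply: ln_le0; exact: distr_le1 (qF.1).
have : q t * k = `|c| + q t by rewrite /k mulrDr mulr1 mulrCA divff ?mulr1 // gt_eqF.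
have := ler_norm (- c); rewrite normrN; nra.
Qed.

(* A sign-definite product [e f(e)] on both sides of 0 is the first-order
   condition [f(0) = 0]. *)
Lemma eq0_of_mul_ge0 (f : R -> R) : {for 0, continuous f} ->
  (\forall e \near 0, 0 <= e * f e) -> f 0 = 0.
Proof.
move=> fc fe; apply/le_anti/andP; split.
- apply: (@cvgr_to_le _ _ _ _ _ _ _ (cvg_at_left_filter fc)).
  near=> e; have e0 : e < 0 by [].
  have : 0 <= e * f e by near: e; exact: cvg_within.
  by rewrite nmulr_rge0.
- apply: (@cvgr_to_ge _ _ _ _ _ _ _ (cvg_at_right_filter fc)).
  near=> e; have e0 : 0 < e by [].
  have : 0 <= e * f e by near: e; exact: cvg_within.
  by rewrite pmulr_rge0.
Unshelve. all: by end_near. Qed.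

(** The key identity: all feasible [q] have the same cross entropy relative to [p]. It is the
    stationarity of [p] along the line through [p] and [q]. *)
Lemma maxent_cross_entropy D C p q : is_maxent D C p -> feasible D C q ->
  \sum_t q t * log2 (p t) = - entropy p.
Proof.
move=> pM qF; have [pF _] := pM.
have [[[p0 p1] _] [[q0 q1] _]] := (pF, qF).
rewrite /entropy opprK; apply/eqP; rewrite -subr_eq0; apply/eqP.
have mc t : mix p q e t @[e --> 0] --> p t.
  under eq_fun do rewrite ffunE.
  have : p t + e * (q t - p t) @[e --> (0 : R)] --> p t + 0 * (q t - p t).
    by apply: cvgD; [exact: cvg_cst | apply: cvgMl; exact: cvg_id].
  by rewrite mul0r addr0.
have m00 t : mix p q 0 t = p t by rewrite ffunE mul0r addr0.
pose f e := \sum_t q t * log2 (mix p q e t) - \sum_t p t * log2 (p t).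
have -> : \sum_t q t * log2 (p t) - \sum_t p t * log2 (p t) = f 0.
  by rewrite /f; congr (_ - _); apply: eq_bigr => t _; rewrite m00.
apply: eq0_of_mul_ge0.
- apply: cvgB; last exact: cvg_cst.
  apply: cvg_big => [|t _]; first exact: add_continuous.
  (* Where [q t = 0] the summand is constantly 0; elsewhere [p t > 0], so [ln] is continuous at
     [p t]. *)
  have := q0 t; rewrite le_eqVlt => /predU1P[<-|qt].
    by under eq_fun do rewrite mul0r; rewrite mul0r; exact: cvg_cst.
  have : ln (mix p q e t) @[e --> 0] --> ln (p t).
    apply: continuous_cvg (mc t).
    by apply: continuous_ln; exact: maxent_support pM qF qt.
  by rewrite -[in X in X -> _](m00 t) => lc; apply: cvgMr; exact: cvgMl.
- have mpos : \forall e \near (0 : R), forall t, 0 < p t -> 0 < mix p q e t.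
    apply: (@filter_forall R _ (fun t e => 0 < p t -> 0 < mix p q e t)
      _ (nbhs_filter (0 : R))) => t.
    have [pt|pt] := ltP 0 (p t); last first.
      by near=> e.
    by near=> e => _; near: e; exact: (cvgr_gt _ (mc t)).
  near=> e; have mp : forall t, 0 < p t -> 0 < mix p q e t by near: e.
  apply: (maxent_mix pM qF) => // [|t].
    by near: e; exact: lt_nbhsl.
  (* Where [p t = 0], support inclusion forces [q t = 0], so the mixture stays at 0 even for
     negative [e]. *)
  have := p0 t; rewrite le_eqVlt => /predU1P[pt|/mp/ltW //].
  have := q0 t; rewrite le_eqVlt => /predU1P[qt|/(maxent_support pM qF)].
    by rewrite ffunE -pt -qt subrr mulr0 addr0.
  by rewrite -pt ltxx.
Unshelve. all: by end_near. Qed.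

(** A maximizer exists by the extreme value theorem: the feasible set is compact, contains the
    empirical distribution, and entropy is continuous. *)
Lemma pstar_maxent D C : D <> [::] -> is_maxent D C (pstar R D C).
Proof.
move=> D0; apply: xgetPex.
pose m := #|{: transaction N}|.
pose of_row (v : 'rV[R]_m) : {ffun transaction N -> R} :=
  [ffun t => v ord0 (enum_rank t)].
pose to_row p : 'rV[R]_m := \row_i p (enum_val i).
have rowK p : of_row (to_row p) = p.
  by apply/ffunP => t; rewrite ffunE mxE enum_rankK.
have oc t : continuous (fun v => of_row v t).
  by under eq_fun do rewrite ffunE; exact: coord_continuous.
have sc (w : transaction N -> R) : continuous (fun v => \sum_t w t * of_row v t).
  apply: continuous_big => [|t _]; first exact: add_continuous.
  by move=> v; apply: cvgMr; [exact: nbhs_filter | exact: oc].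
pose A := [set v | feasible D C (of_row v)].
have Acl : closed A.
  (* Each constraint is a closed condition on a continuous function; the weight 1 makes the total
     mass an instance of [sc]. *)
  have -> : A = (\bigcap_(t in [set: transaction N])
       (fun v => of_row v t) @^-1` [set x | 0 <= x])
    `&` ((fun v => \sum_t 1 * of_row v t) @^-1` [set x | x = 1])
    `&` \bigcap_(X in [set X | X \in C])
       ((fun v => \sum_t (supports X t)%:R * of_row v t)
          @^-1` [set x | x = freq R D X]).
    apply/seteqP; split => v /=.
      move=> [[p0 p1] pC]; split; first split => [t _|/=]; first exact: p0.
        by under eq_bigr do rewrite mul1r.
      by move=> X XC /=; rewrite -prob_itemset_sum pC.
    move=> [[p0 p1] pC]; split; first split => [t|]; first exact: p0.
      by rewrite -p1; under [RHS]eq_bigr do rewrite mul1r.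
    by move=> X XC; rewrite prob_itemset_sum; exact: pC.
  apply: closedI; first apply: closedI.
  - apply: closed_bigI => t _; apply: preimage_closed; last exact: closed_ge.
    by move=> v _; exact: oc.
  - by apply: preimage_closed; [move=> v _; exact: sc | exact: closed_eq].
  - apply: closed_bigI => X _; apply: preimage_closed; last exact: closed_eq.
    by move=> v _; exact: sc.
have Acp : compact A.
  have : compact [set v : 'rV[R]_m | forall i, v ord0 i \in `[(0 : R), 1]].
    apply: (@rV_compact _ _ (fun=> `[(0 : R), 1]%classic)) => _.
    exact: segment_compact.
  move/(subclosed_compact Acl); apply => v [vd _] i /=.
  have := distr_le1 (enum_val i) vd; have := vd.1 (enum_val i).
  by rewrite ffunE enum_valK in_itv /= => -> ->.
have [||v] := @EVT_max_rV R m (fun v => entropy (of_row v)) A _ Acp.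
- by exists (to_row (empirical R D)); rewrite /A /= rowK; exact: feasible_empirical.
- apply: continuous_subspaceT.
  have ec : continuous (fun v => \sum_t of_row v t * log2 (of_row v t)).
    apply: continuous_big => [|t _]; first exact: add_continuous.
    move=> v; apply: (@continuous_comp _ _ _ (fun v => of_row v t)
      (fun x : R => x * log2 x)); first exact: oc.
    exact: continuous_xlog2x.
  by move=> v; apply: cvgN; [exact: nbhs_filter | exact: ec].
rewrite inE => vA vmax; exists (of_row v); split => // q qF.
by have := vmax (to_row q); rewrite rowK inE /A /= rowK; exact.
Qed.

(** * Divergence and log-likelihood in terms of entropy *)

Lemma elog2_EFin (x : R) : 0 < x -> elog2 x%:E = (log2 x)%:E.
Proof. by move=> x0; rewrite /elog2 lne_EFin. Qed.

Lemma KL_EFin p q : (forall t, 0 <= p t) -> (forall t, 0 < p t -> 0 < q t) ->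
  KL p q = (- entropy p - \sum_t p t * log2 (q t))%:E.
Proof.
move=> p0 pq; rewrite /KL /entropy opprK -sumrB -sumEFin; apply: eq_bigr => t _.
have := p0 t; rewrite le_eqVlt => /predU1P[<-|pt].
  by rewrite !mul0r mul0e subr0.
have qt := pq t pt.
rewrite inver gt_eqF // -EFinM elog2_EFin ?divr_gt0 // -EFinM -mulrBr.
by rewrite /log2 ln_div ?posrE // mulrBl.
Qed.

Lemma KL_pstar D C p : D <> [::] -> feasible D C p ->
  KL p (pstar R D C) = (entropy (pstar R D C) - entropy p)%:E.
Proof.
move=> D0 pF; have pM := pstar_maxent C D0.
rewrite (KL_EFin pF.1.1 (fun t => @maxent_support D C _ _ t pM pF)).
by rewrite (maxent_cross_entropy pM pF) addrC opprK.
Qed.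

(** Grouping equal transactions turns the log-likelihood into [size D] times the sum of
    [q_D log p*]. Transactions of [D] have positive [p*] by support inclusion, so every logarithm is
    finite. *)
Lemma loglik_pstar D C : D <> [::] ->
  loglik (pstar R D C) D = (- ((size D)%:R * entropy (pstar R D C)))%:E.
Proof.
move=> D0; have pM := pstar_maxent C D0; have eF := feasible_empirical C D0.
have n0 : 0 < (size D)%:R :> R by rewrite ltr0n lt0n size_eq0; apply/eqP.
have := maxent_cross_entropy pM eF => /(congr1 ( *%R (size D)%:R)).
rewrite mulrN => <-; rewrite mulr_sumr.
under eq_bigr do rewrite ffunE mulrA [(size D)%:R * _]mulrC divfK ?gt_eqF //.
rewrite -sum_count_mem -sumEFin /loglik big_seq [RHS]big_seq.
apply: eq_bigr => t tD; rewrite elog2_EFin //.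
apply: (maxent_support pM eF); rewrite ffunE divr_gt0 // ltr0n.
by rewrite -has_count has_pred1.
Qed.

End Distributions.

Theorem theorem6p1 (R : realType) (N : nat) (hN : (0 < N)%N)
    (D : seq (transaction N)) (hD : D <> [::])
    (C : seq (itemset N)) (F : {set itemset N}) (s : score_kind) :
  argmin F (fun X => score R s (add_itemset C X) D)
  = argmax F (fun X => (KL (pstar R D (add_itemset C X)) (pstar R D C)
                        - (penalty R s D X)%:E)%E)
  /\
  argmax F (fun X => (KL (pstar R D (add_itemset C X)) (pstar R D C)
                      - (penalty R s D X)%:E)%E)
  = argmin F (fun X => (KL (empirical R D) (pstar R D (add_itemset C X))
                        + (penalty R s D X)%:E)%E).
Proof.
pose n : R := (size D)%:R.
have n0 : 0 < n by rewrite ltr0n lt0n size_eq0; apply/eqP.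
pose g X := entropy (pstar R D (add_itemset C X)) + penalty R s D X.
(* The score is an increasing affine function of [g]; [c] gathers the terms common to all
   candidates, such as those in the size of the collection. *)
have scoreE : exists c, forall X,
    score R s (add_itemset C X) D = (n * g X + c)%:E.
  rewrite /g; case: s {g}; rewrite /= /BIC /MDL /add_itemset.
  - exists ((size C).+1%:R / 2 * log2 n) => X.
    by rewrite loglik_pstar // size_rcons -EFinN opprK -EFinD addr0.
  - exists (mdl_l1 R D * (size C).+1%:R
            + mdl_l2 R N * (\sum_(Y <- C) #|Y|)%:R + 1) => X.
    rewrite loglik_pstar // size_rcons -EFinN opprK -EFinD -cats1 big_cat big_seq1.
    rewrite natrD -/n /mdl_l2; congr EFin; field; exact: lt0r_neq0.
have [c {}scoreE] := scoreE.
have klE X : (KL (pstar R D (add_itemset C X)) (pstar R D C)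
              - (penalty R s D X)%:E)%E = (entropy (pstar R D C) - g X)%:E.
  rewrite KL_pstar // -?EFinB /g ?opprD ?addrA //.
  (* The constraints of [C] are among those of the extended collection, so its maximizer is feasible
     for [C]. *)
  have [[pd pC] _] := pstar_maxent R (add_itemset C X) hD.
  by split=> // Y YC; apply: pC; rewrite mem_rcons inE YC orbT.
have kqE X : (KL (empirical R D) (pstar R D (add_itemset C X))
              + (penalty R s D X)%:E)%E = (g X - entropy (empirical R D))%:E.
  rewrite KL_pstar // -?EFinD /g; first by congr EFin; ring.
  exact: feasible_empirical.
(* Each comparison of objective values reduces to comparing [g X] with [g Y]; the sign of [g] in the
   first divergence turns argmax into argmin. *)
split; apply/setP => X; rewrite !inE; congr (_ && _);
  apply: eq_forallb => Y; congr (_ ==> _).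
- by rewrite !scoreE !klE !lee_fin lerD2r ler_pM2l // lerD2l lerN2.
- by rewrite !kqE !klE !lee_fin lerD2r lerD2l lerN2.
Qed.
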